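(* Let $m_a=m_b\in C^2[0,1]$ be a mobility function satisfying: $m_a(s)>0$ for $s>0$ and $m_a(0)=0$; $m_a'(s)>0$ for $s>0$ and $m_a'(0)=0$; $m_a''(s)>0$ for $s>0$. Additionally, let $$\left.\left(\frac{m_a''}{m_a^3}\right)'\right|_{s=0.5}>0.$$ Then the corresponding fractional flow function $$f(s)=\frac{m_a(s)}{m_a(s)+m_b(1-s)}$$ has more than one inflection point and therefore is not S-shaped.
   Context: An inflection point of $f$ is a point $s\in(0,1)$ at which $f''(s)=0$. The function $f$ is called S-shaped if there exists a unique inflection point $s^*\in(0,1)$, such that $f''(s^* )=0$. The displayed condition at $s=0.5$ presupposes that $m_a''/m_a^3$ is differentiable there. *)

(* Defs.v *)
From Stdlib Require Import Reals.
From Coquelicot Require Import Coquelicot.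
Open Scope R_scope.

Definition I01 (s : R) : Prop := 0 <= s <= 1.

(* [m] belongs to C^2[0,1], with first and second derivatives [m1] and [m2].
   Derivatives and continuity are relative to [0,1], hence one-sided at 0 and 1;
   values outside [0,1] are irrelevant. *)
Definition C2_01 (m m1 m2 : R -> R) : Prop :=
  forall s, I01 s ->
    D_in m m1 I01 s /\ D_in m1 m2 I01 s /\ continue_in m2 I01 s.

Definition fractional_flow (ma mb : R -> R) (s : R) : R :=
  ma s / (ma s + mb (1 - s)).

(* [Derive] is total, so differentiability of [f] around [s] is required
   explicitly: f''(s) exists and equals 0. *)
Definition inflection_point (f : R -> R) (s : R) : Prop :=
  0 < s < 1 /\ locally s (ex_derive f) /\ is_derive_n f 2 s 0.

Definition S_shaped (f : R -> R) : Prop :=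
  exists! s, inflection_point f s.

(* Main.v *)
Require Import Defs.
From Stdlib Require Import Reals Ranalysis5 Lra.
From Coquelicot Require Import Coquelicot.
Open Scope R_scope.

(** Write [a s = m s], [b s = m (1 - s)] and [D = a + b]. Then [f''] has the sign of
    [G = (a'' b - a b'') D - 2 (a' b - a b') D'], which is antisymmetric about
    [1/2], so [1/2] is an inflection point. Since [f' 0 = 0] while [f' > 0] on
    [(0,1)], the mean value theorem gives a point of [(0,1/2)] where [G > 0].
    On the other hand [G' (1/2) = 4 m^5 (m''/m^3)' (1/2) > 0], so [G < 0] just to
    the left of [1/2]; hence [G] has another zero in [(0,1/2)]. *)

(** * From calculus relative to [0,1] to two-sided calculus *)

Lemma D_in_I01_is_derive (g g' : R -> R) (s : R) :
  0 < s < 1 -> D_in g g' I01 s -> is_derive g s (g' s).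
Proof.
intros hs hD; apply is_derive_Reals; intros eps heps.
destruct (hD eps heps) as [al [hal H]].
(* Bounding the increment also by the distances to 0 and 1 keeps [s + h] inside [0,1], where the
   relative derivative applies. *)
assert (hd : 0 < Rmin al (Rmin s (1 - s))) by (repeat apply Rmin_pos; lra).
exists (mkposreal _ hd); simpl; intros h hh0 hh.
pose proof (Rmin_l al (Rmin s (1 - s))).
pose proof (Rmin_r al (Rmin s (1 - s))).
pose proof (Rmin_l s (1 - s)); pose proof (Rmin_r s (1 - s)).
assert (Habs : Rabs h < s /\ Rabs h < 1 - s /\ Rabs h < al) by lra.
pose proof (Rle_abs h); pose proof (Rle_abs (- h)) as Hm; rewrite Rabs_Ropp in Hm.
specialize (H (s + h)); simpl in H; unfold Rdist in H.
replace (s + h - s) with h in H by ring.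
apply H; split; [split; [unfold I01|]|]; lra.
Qed.

Definition clamp01 (x : R) : R := Rmax 0 (Rmin x 1).

Lemma clamp01_I01 (x : R) : I01 (clamp01 x).
Proof.
unfold I01, clamp01, Rmax, Rmin.
destruct (Rle_dec x 1); destruct (Rle_dec 0 _); lra.
Qed.

Lemma clamp01_id (x : R) : I01 x -> clamp01 x = x.
Proof. intros [h0 h1]; unfold clamp01; rewrite Rmin_left, Rmax_right; lra. Qed.

Lemma clamp01_lipschitz (x y : R) :
  Rabs (clamp01 x - clamp01 y) <= Rabs (x - y).
Proof.
unfold clamp01, Rmax, Rmin.
destruct (Rle_dec x 1); destruct (Rle_dec y 1);
  repeat destruct (Rle_dec 0 _); apply Rabs_le; unfold Rabs;
  destruct (Rcase_abs (x - y)); lra.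
Qed.

(* Composing with the clamp turns relative continuity on [0,1], one-sided at the
   end points, into two-sided continuity. *)
Lemma continue_in_clamp01 (g : R -> R) (x : R) :
  continue_in g I01 (clamp01 x) -> continuous (fun y => g (clamp01 y)) x.
Proof.
intros hg; apply continuity_pt_filterlim; intros eps heps.
destruct (hg eps heps) as [al [hal H]].
exists al; split; [exact hal|]; simpl in *; intros y [_ hy].
(* The limit in [continue_in] excludes the base point itself, yet the clamp can send distinct points
   to the same value. *)
destruct (Req_dec (clamp01 y) (clamp01 x)) as [e | ne].
- rewrite e; unfold Rdist; rewrite Rminus_diag, Rabs_R0; exact heps.
- apply H; split; [split; [apply clamp01_I01 | auto]|].
  apply Rle_lt_trans with (2 := hy); apply clamp01_lipschitz.
Qed.

Lemma continue_in_I01_continuous (g : R -> R) (s : R) :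
  0 < s < 1 -> continue_in g I01 s -> continuous g s.
Proof.
intros hs hg.
apply continuous_ext_loc with (fun y => g (clamp01 y)).
- apply (locally_interval _ s 0 1); try (simpl; lra).
  intros y h0 h1; simpl in *; rewrite clamp01_id; [reflexivity | split; lra].
- apply continue_in_clamp01; rewrite clamp01_id; [exact hg | split; lra].
Qed.

Lemma is_derive_pos_left (g : R -> R) (c x l : R) :
  is_derive g x l -> 0 < l -> c < x -> exists d, c < d < x /\ g d < g x.
Proof.
intros hg hl hc; apply is_derive_Reals in hg.
destruct (hg l hl) as [del H].
set (h := - (Rmin del (x - c) / 2)).
pose proof (Rmin_l del (x - c)); pose proof (Rmin_r del (x - c)).
assert (0 < Rmin del (x - c)) by (apply Rmin_pos; [apply cond_pos | lra]).
assert (hh : h < 0) by (unfold h; lra).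
exists (x + h); split; [unfold h; lra|].
(* With tolerance [l] itself the difference quotient is positive, so the increment of [g] has the
   sign of [h], which is negative. *)
assert (hQ : Rabs ((g (x + h) - g x) / h - l) < l).
{ apply H; [lra|]; rewrite Rabs_left; unfold h in *; lra. }
apply Rabs_def2 in hQ.
assert (e : g (x + h) - g x = (g (x + h) - g x) / h * h) by (field; lra).
nra.
Qed.

(** * First and second derivatives of the flow *)

Section SymmetricFlow.

Variables m m1 m2 : R -> R.

Definition flow_denom (s : R) : R := m s + m (1 - s).

(** This is a' b - a b'; the plus sign comes from b'(s) = - m'(1 - s). *)
Definition flow_slope_num (s : R) : R := m1 s * m (1 - s) + m s * m1 (1 - s).

Definition flow_slope (s : R) : R := flow_slope_num s / flow_denom s ^ 2.

(** This is [G], the numerator of f'' over D^3. The a' b' terms cancel in (a' b - a b')', and the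
    last factor is D'. *)
Definition flow_curv_num (s : R) : R :=
  (m2 s * m (1 - s) - m s * m2 (1 - s)) * flow_denom s
  - 2 * flow_slope_num s * (m1 s - m1 (1 - s)).

Hypothesis hC2 : C2_01 m m1 m2.
Hypothesis hm_pos : forall s, 0 < s <= 1 -> 0 < m s.

Lemma is_derive_mobility (s : R) : 0 < s < 1 -> is_derive m s (m1 s).
Proof.
intros hs; apply D_in_I01_is_derive; [exact hs|].
apply hC2; split; lra.
Qed.

Lemma is_derive_mobility1 (s : R) : 0 < s < 1 -> is_derive m1 s (m2 s).
Proof.
intros hs; apply D_in_I01_is_derive; [exact hs|].
apply hC2; split; lra.
Qed.

Lemma continuous_mobility2 (s : R) : 0 < s < 1 -> continuous m2 s.
Proof.
intros hs; apply continue_in_I01_continuous; [exact hs|].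
apply hC2; split; lra.
Qed.

Lemma flow_denom_pos (s : R) : 0 < s < 1 -> 0 < flow_denom s.
Proof.
intros hs; unfold flow_denom.
apply Rplus_lt_0_compat; apply hm_pos; lra.
Qed.

Lemma is_derive_flow (s : R) :
  0 < s < 1 -> is_derive (fractional_flow m m) s (flow_slope s).
Proof.
intros hs.
pose proof (is_derive_mobility s hs) as d.
assert (hs' : 0 < 1 - s < 1) by lra.
pose proof (is_derive_mobility _ hs') as d'.
pose proof (flow_denom_pos s hs) as hD; unfold flow_denom in hD.
unfold fractional_flow, flow_slope, flow_slope_num, flow_denom.
unfold Rminus in *.
auto_derive.
- repeat split; try (eexists; eassumption); lra.
- rewrite (is_derive_unique (fun x : R => m x) _ _ d).
  rewrite (is_derive_unique (fun x : R => m x) _ _ d').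
  field; lra.
Qed.

Lemma is_derive_flow_slope (s : R) :
  0 < s < 1 ->
  is_derive flow_slope s (flow_curv_num s / flow_denom s ^ 3).
Proof.
intros hs.
assert (hs' : 0 < 1 - s < 1) by lra.
pose proof (is_derive_mobility s hs) as d.
pose proof (is_derive_mobility _ hs') as d'.
pose proof (is_derive_mobility1 s hs) as e.
pose proof (is_derive_mobility1 _ hs') as e'.
pose proof (flow_denom_pos s hs) as hD; unfold flow_denom in hD.
unfold flow_curv_num, flow_slope, flow_slope_num, flow_denom.
unfold Rminus in *.
auto_derive.
- repeat split; try (eexists; eassumption); nra.
- rewrite (is_derive_unique (fun x : R => m x) _ _ d).
  rewrite (is_derive_unique (fun x : R => m x) _ _ d').
  rewrite (is_derive_unique (fun x : R => m1 x) _ _ e).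
  rewrite (is_derive_unique (fun x : R => m1 x) _ _ e').
  field; lra.
Qed.

Lemma inflection_point_flow (s : R) :
  0 < s < 1 -> flow_curv_num s = 0 ->
  inflection_point (fractional_flow m m) s.
Proof.
intros hs h0.
assert (hloc : locally s (fun x => 0 < x < 1)).
{ apply (locally_interval _ s 0 1); simpl; try lra; intros; lra. }
split; [exact hs | split].
- apply filter_imp with (2 := hloc); intros x hx; exists (flow_slope x).
  exact (is_derive_flow x hx).
(* The second derivative is taken of the total function [Derive], which agrees with [flow_slope]
   only near [s]; local agreement suffices. *)
- change (is_derive (Derive (fractional_flow m m)) s 0).
  apply is_derive_ext_loc with flow_slope.
  + apply filter_imp with (2 := hloc); intros x hx; symmetry.
    exact (is_derive_unique _ _ _ (is_derive_flow x hx)).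
  + replace 0 with (flow_curv_num s / flow_denom s ^ 3).
    * exact (is_derive_flow_slope s hs).
    * rewrite h0; unfold Rdiv; ring.
Qed.

Lemma continuous_flow_curv_num (s : R) :
  0 < s < 1 -> continuous flow_curv_num s.
Proof.
intros hs.
assert (refl : forall g : R -> R, (forall x, 0 < x < 1 -> continuous g x) ->
          continuous (fun x => g (1 - x)) s).
{ intros g hg; apply (continuous_comp (fun x => 1 - x) g).
  - apply (continuous_minus (fun _ => 1) (fun x => x));
      [apply continuous_const | apply continuous_id].
  - apply hg; lra. }
assert (c : forall x, 0 < x < 1 -> continuous m x).
{ intros x hx; apply @ex_derive_continuous; eexists.
  exact (is_derive_mobility x hx). }
assert (c1 : forall x, 0 < x < 1 -> continuous m1 x).
{ intros x hx; apply @ex_derive_continuous; eexists.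
  exact (is_derive_mobility1 x hx). }
pose proof continuous_mobility2 as c2.
pose proof (refl _ c) as r; pose proof (refl _ c1) as r1.
pose proof (refl _ c2) as r2.
specialize (c s hs); specialize (c1 s hs); specialize (c2 s hs).
unfold flow_curv_num, flow_slope_num, flow_denom.
apply continuity_pt_filterlim.
apply continuity_pt_filterlim in c, c1, c2, r, r1, r2.
repeat first [ assumption
  | apply continuity_pt_minus | apply continuity_pt_plus
  | apply continuity_pt_mult
  | apply continuity_pt_const; intros ? ?; reflexivity ].
Qed.

Lemma flow_curv_num_half : flow_curv_num (1 / 2) = 0.
Proof.
unfold flow_curv_num; replace (1 - 1 / 2) with (1 / 2) by field; ring.
Qed.

(** At 1/2 both D' and a'' b - a b'' vanish, D = 2m and D'' = 2m''. Hence G' = 4m (m m''' - 3 m'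
    m''), while q' = (m m''' - 3 m' m'') / m^4 for q = m''/m^3. *)
Lemma is_derive_flow_curv_num_half (q' : R) :
  is_derive (fun s => m2 s / m s ^ 3) (1 / 2) q' ->
  is_derive flow_curv_num (1 / 2) (4 * m (1 / 2) ^ 5 * q').
Proof.
intros hq.
assert (hh : 0 < 1 / 2 < 1) by lra.
pose proof (is_derive_mobility _ hh) as d.
pose proof (is_derive_mobility1 _ hh) as e.
assert (hm : 0 < m (1 / 2)) by (apply hm_pos; lra).
(* As [m] is only C^2, m''' at 1/2 is obtained from the product rule applied to m'' = q m^3. *)
assert (k : is_derive m2 (1 / 2)
  (q' * m (1 / 2) ^ 3 + 3 * m2 (1 / 2) * m1 (1 / 2) / m (1 / 2))).
{ apply is_derive_ext_loc with (fun s => m2 s / m s ^ 3 * m s ^ 3).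
  - apply (locally_interval _ _ 0 1); try (simpl; lra).
    intros y h0 h1; simpl in h0, h1.
    assert (0 < m y) by (apply hm_pos; lra).
    change (m2 y / m y ^ 3 * m y ^ 3 = m2 y); field; lra.
  (* Naming the quotient makes [auto_derive] treat it as one function with derivative [q'], instead
     of asking for the derivative of [m2]. *)
  - set (q := fun s => m2 s / m s ^ 3) in *.
    apply is_derive_ext with (fun s => q s * m s ^ 3); [reflexivity|].
    auto_derive.
    + repeat split; eexists; eassumption.
    + rewrite (is_derive_unique (fun x : R => m x) _ _ d).
      rewrite (is_derive_unique (fun x : R => q x) _ _ hq).
      unfold q; field; lra. }
unfold flow_curv_num, flow_slope_num, flow_denom.
auto_derive; replace (1 + - (1 / 2)) with (1 / 2) by field.
- repeat split; eexists; eassumption.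
- rewrite (is_derive_unique (fun x : R => m x) _ _ d).
  rewrite (is_derive_unique (fun x : R => m1 x) _ _ e).
  rewrite (is_derive_unique (fun x : R => m2 x) _ _ k).
  field; lra.
Qed.

(** * Behaviour of the slope near 0 *)

Hypothesis hm_0 : m 0 = 0.
Hypothesis hm1_0 : m1 0 = 0.
Hypothesis hm1_pos : forall s, 0 < s <= 1 -> 0 < m1 s.

Lemma flow_slope_pos (s : R) : 0 < s < 1 -> 0 < flow_slope s.
Proof.
intros hs; apply Rdiv_lt_0_compat.
- apply Rplus_lt_0_compat; apply Rmult_lt_0_compat;
    first [apply hm_pos | apply hm1_pos]; lra.
- apply pow_lt, flow_denom_pos, hs.
Qed.

(** The slope tends to 0 at 0 from the right: its numerator vanishes there because m(0) = m'(0) = 0,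
    and its denominator tends to m(1)^2 > 0. *)
Lemma flow_slope_arbitrarily_small (eps x : R) :
  0 < eps -> 0 < x < 1 -> exists e, 0 < e < x /\ flow_slope e < eps.
Proof.
intros heps hx.
set (M := fun y => m (clamp01 y)); set (M1 := fun y => m1 (clamp01 y)).
assert (cM : forall y, continuity_pt M y).
{ intros y; apply continuity_pt_filterlim, continue_in_clamp01.
  apply cont_deriv with m1, hC2, clamp01_I01. }
assert (cM1 : forall y, continuity_pt M1 y).
{ intros y; apply continuity_pt_filterlim, continue_in_clamp01.
  apply cont_deriv with m2, hC2, clamp01_I01. }
assert (refl : forall g, (forall y, continuity_pt g y) ->
          continuity_pt (fun y => g (1 - y)) 0).
{ intros g hg; apply (continuity_pt_comp (fun y => 1 - y) g); [|apply hg].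
  apply continuity_pt_minus;
    [apply continuity_pt_const; intros ? ?; reflexivity|].
  apply continuity_pt_id. }
(* [F] agrees with [flow_slope] on (0,1), and clamping its ingredients makes it continuous at 0 from
   both sides. *)
set (F := fun y => (M1 y * M (1 - y) + M y * M1 (1 - y))
                   * / ((M y + M (1 - y)) * (M y + M (1 - y)))).
assert (M0 : M 0 = 0) by (unfold M; rewrite clamp01_id; [exact hm_0 | split; lra]).
assert (M10 : M1 0 = 0)
  by (unfold M1; rewrite clamp01_id; [exact hm1_0 | split; lra]).
assert (hM1 : 0 < M (1 - 0)).
{ unfold M; rewrite clamp01_id; [apply hm_pos | split]; lra. }
assert (F0 : F 0 = 0) by (unfold F; rewrite M0, M10; ring).
assert (cF : continuity_pt F 0).
{ pose proof (refl _ cM); pose proof (refl _ cM1).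
  pose proof (cM 0); pose proof (cM1 0).
  unfold F; apply continuity_pt_mult.
  - apply continuity_pt_plus; apply continuity_pt_mult; assumption.
  - apply continuity_pt_inv.
    + apply continuity_pt_mult; apply continuity_pt_plus; assumption.
    + rewrite M0; nra. }
destruct (cF eps heps) as [al [hal H]]; simpl in H.
set (e := Rmin al x / 2).
pose proof (Rmin_l al x); pose proof (Rmin_r al x).
assert (0 < Rmin al x) by (apply Rmin_pos; lra).
assert (he : 0 < e < x) by (unfold e; lra).
exists e; split; [exact he|].
assert (HF : Rdist (F e) (F 0) < eps).
{ apply H; split; [split; [exact I | lra]|].
  unfold Rdist; rewrite Rminus_0_r, Rabs_pos_eq; unfold e; lra. }
unfold Rdist in HF; rewrite F0, Rminus_0_r in HF.
replace (flow_slope e) with (F e).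
- apply Rle_lt_trans with (2 := HF), Rle_abs.
- unfold F, M, M1, flow_slope, flow_slope_num, flow_denom, Rdiv.
  rewrite !clamp01_id by (split; lra); simpl; rewrite Rmult_1_r; reflexivity.
Qed.

(** The mean value theorem is applied on [e, x] with e > 0 and a smaller slope at [e] than at [x],
    so that only two-sided derivatives inside (0,1) are needed. *)
Lemma flow_curv_num_pos_left (x : R) :
  0 < x < 1 -> exists c, 0 < c <= x /\ 0 < flow_curv_num c.
Proof.
intros hx.
destruct (flow_slope_arbitrarily_small (flow_slope x) x) as [e [he hlt]];
  [apply flow_slope_pos, hx | exact hx |].
destruct (MVT_gen flow_slope e x
  (fun s => flow_curv_num s / flow_denom s ^ 3)) as [c [hc heq]].
- intros y hy; rewrite Rmin_left, Rmax_right in hy by lra.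
  apply is_derive_flow_slope; lra.
- intros y hy; rewrite Rmin_left, Rmax_right in hy by lra.
  apply continuity_pt_filterlim; apply @ex_derive_continuous; eexists.
  apply is_derive_flow_slope; lra.
- rewrite Rmin_left, Rmax_right in hc by lra.
  exists c; split; [lra|].
  assert (hD : 0 < flow_denom c ^ 3) by (apply pow_lt, flow_denom_pos; lra).
  replace (flow_curv_num c)
    with (flow_curv_num c / flow_denom c ^ 3 * flow_denom c ^ 3) by (field; nra).
  apply Rmult_lt_0_compat; [nra | exact hD].
Qed.

End SymmetricFlow.

Theorem theorem3 (m m1 m2 : R -> R)
  (hC2 : C2_01 m m1 m2)
  (hm_pos : forall s, 0 < s <= 1 -> 0 < m s)
  (hm_0 : m 0 = 0)
  (hm1_pos : forall s, 0 < s <= 1 -> 0 < m1 s)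
  (hm1_0 : m1 0 = 0)
  (hm2_pos : forall s, 0 < s <= 1 -> 0 < m2 s)
  (hdiff : ex_derive (fun s => m2 s / m s ^ 3) (1 / 2))
  (hder : 0 < Derive (fun s => m2 s / m s ^ 3) (1 / 2)) :
  (exists s1 s2, s1 <> s2 /\
     inflection_point (fractional_flow m m) s1 /\
     inflection_point (fractional_flow m m) s2) /\
  ~ S_shaped (fractional_flow m m).
Proof.
assert (two : exists s1 s2, s1 <> s2 /\
     inflection_point (fractional_flow m m) s1 /\
     inflection_point (fractional_flow m m) s2).
{ set (G := flow_curv_num m m1 m2).
  assert (G0 : G (1 / 2) = 0) by apply flow_curv_num_half.
  (* Any value in (0,1/2) would do for 1/4; it forces c < 1/2 strictly, leaving room for [d] between
     them. *)
  destruct (flow_curv_num_pos_left m m1 m2 hC2 hm_pos hm_0 hm1_0 hm1_pos (1 / 4))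
    as [c [hc hGc]]; [lra|].
  destruct (is_derive_pos_left G c (1 / 2)
    (4 * m (1 / 2) ^ 5 * Derive (fun s => m2 s / m s ^ 3) (1 / 2)))
    as [d [hd hGd]].
  - apply is_derive_flow_curv_num_half; auto.
    apply Derive_correct, hdiff.
  - apply Rmult_lt_0_compat; [|exact hder].
    apply Rmult_lt_0_compat; [lra | apply pow_lt, hm_pos; lra].
  - lra.
  (* [IVT_interv] wants a change from negative to positive, whereas [G] is positive at [c] and
     negative at [d]. The zero satisfies z <= d < 1/2, so it differs from 1/2. *)
  - destruct (IVT_interv (fun x => - G x) c d) as [z [hz hGz]].
    + intros a ha; apply continuity_pt_opp, continuity_pt_filterlim.
      apply continuous_flow_curv_num; auto; lra.
    + lra.
    + unfold G; lra.
    + lra.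
    + exists z, (1 / 2); split; [lra | split];
        apply inflection_point_flow with m1 m2; auto; try lra.
      unfold G in hGz; lra. }
split; [exact two|].
intros [s [_ huniq]]; destruct two as [s1 [s2 [hne [h1 h2]]]].
apply hne; rewrite <- (huniq s1 h1); apply huniq, h2.
Qed.
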